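(* Let $N=1$. Then for any $k\in\mathbb{N}$ there exist $1<q_0<p_0$ such that $$\frac{\|\varphi_q'\|_p^p}{\|\varphi_q\|_p^p}>\lambda_k(p)$$ for all $1<q<q_0$ and $p>p_0$.
   Context: Here $\Omega=(0,T)$ with $T>0$, and $\|\cdot\|_r$ is the norm of $L^r(0,T)$. For $r>1$ consider the Dirichlet eigenvalue problem $-(|u'|^{r-2}u')'=\lambda|u|^{r-2}u$ in $(0,T)$, $u(0)=u(T)=0$. Its eigenvalues are exactly $\lambda_k(r)=(r-1)\left(\frac{k\pi_r}{T}\right)^r$, $k\in\mathbb{N}=\{1,2,\dots\}$, with $\pi_r=\frac{2\pi}{r\sin(\pi/r)}$. The first eigenfunction (corresponding to $\lambda_1(r)$, unique up to a nonzero multiplier) is $\varphi_r(t)=\sin_r(\pi_r t/T)$, where $\sin_r$ is the inverse function of $x\mapsto\int_0^x(1-s^r)^{-1/r}\,ds$, $x\in[0,1]$, extended periodically and anti-periodically from $[0,\pi_r/2]$ to $\mathbb{R}$ in the usual way (as for the sine function). *)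

(* Defs.v *)
From HB Require Import structures.
From mathcomp Require Import all_boot all_order all_algebra.
From mathcomp Require Import all_classical all_reals all_analysis.

Set Implicit Arguments.
Unset Strict Implicit.
Unset Printing Implicit Defensive.

Import Order.TTheory GRing.Theory Num.Theory.
Import numFieldNormedType.Exports.

Local Open Scope classical_set_scope.
Local Open Scope ring_scope.

Definition pi_gen (R : realType) (r : R) : R := 2 * pi / (r * sin (pi / r)).

(* At s = 1 the integrand is the junk value 0, which does not affect the
   Lebesgue integral. *)
Definition arcsin_gen (R : realType) (r x : R) : R :=
  \int[lebesgue_measure]_(s in `[0, x]) ((1 - s `^ r) `^ (- r^-1)).

(* The inverse of arcsin_gen r on [0, 1]; its domain arcsin_gen r @` [0, 1] is
   [0, pi_gen r / 2] when 1 < r, and it is 0 elsewhere. *)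
Definition sin_gen_quarter (R : realType) (r : R) : R -> R :=
  'pinv_(fun=> 0) `[0, 1] (arcsin_gen r).

(* Reflection of sin_gen_quarter about pi_gen r / 2 on [0, pi_gen r], then
   extension by sin_gen r (y + pi_gen r) = - sin_gen r y. *)
Definition sin_gen (R : realType) (r y : R) : R :=
  let n : int := Num.floor (y / pi_gen r) in
  let z := y - n%:~R * pi_gen r in
  (-1) ^ n * sin_gen_quarter r (if z <= pi_gen r / 2 then z else pi_gen r - z).

Definition lambda (R : realType) (T : R) (k : nat) (r : R) : R :=
  (r - 1) * (k%:R * pi_gen r / T) `^ r.

Definition phi (R : realType) (T r : R) : R -> R :=
  fun t => sin_gen r (pi_gen r * t / T).

(* The norm of L^r(0, T), with values in the extended reals. *)
Definition Lnorm0T (R : realType) (T r : R) (f : R -> R) : \bar R :=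
  'N[lebesgue_measure]_(r%:E)[(EFin \o f) \_ `]0, T[].

(* Main.v *)
(* As q decreases to 1, pi_gen q tends to infinity (it is at least 2 / (q - 1)),
   while pi_gen p stays bounded by B := 2 / cos 1 for p large.  Since
   0 <= sin_gen q y <= y near 0, the derivative
   (pi_gen q / T) (1 - sin_gen^q)^(1/q) of phi T q is at least
   3/4 * pi_gen q / T on ]0, T / (4 pi_gen q)[, and |phi T q| <= 1.  With
   M := pi_gen q, the quotient is thus at least (4 M)^-1 (3/4 * M / T)^p, which
   exceeds (p - 1) (k B / T)^p for all large p, uniformly in q, as soon as
   3/4 * M >= e^2 k B. *)
Require Import Defs.
From mathcomp Require Import all_boot all_order all_algebra.
From mathcomp Require Import all_classical all_reals all_analysis.
From mathcomp Require Import measurable_realfun ring lra.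

Set Implicit Arguments.
Unset Strict Implicit.
Unset Printing Implicit Defensive.

Import Order.TTheory GRing.Theory Num.Theory.
Import numFieldNormedType.Exports.

Local Open Scope classical_set_scope.
Local Open Scope ring_scope.

(** * Bounds for the sine and for [pi_gen] *)

Lemma sin_le_id (R : realType) (x : R) : 0 <= x -> sin x <= x.
Proof.
rewrite le_eqVlt => /predU1P[<-|x0]; first by rewrite sin0.
have [|c _] := @MVT R sin cos 0 x x0 (fun y _ => is_derive_sin y).
  by apply: continuous_subspaceT => y; exact: continuous_sin.
by rewrite sin0 !subr0 => ->; rewrite ler_piMl ?cos_le1// ltW.
Qed.

Lemma sin_ge_cos1M (R : realType) (x : R) : 0 <= x <= 1 -> cos 1 * x <= sin x.
Proof.
rewrite le_eqVlt => /andP[/predU1P[<- _|x0 x1]]; first by rewrite sin0 mulr0.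
have [|c /[!in_itv]/= /andP[c0 cx]] :=
    @MVT R sin cos 0 x x0 (fun y _ => is_derive_sin y).
  by apply: continuous_subspaceT => y; exact: continuous_sin.
rewrite sin0 !subr0 => ->; rewrite ler_wpM2r ?(ltW x0)// ltW//.
have pi2 := pi_ge2 R.
by rewrite ltr_cos ?in_itv/= ; lra.
Qed.

(** Since sin (pi / q) = sin (pi - pi / q), the sine is at most pi (q - 1) / q, which is small for q
    near 1. *)
Lemma pi_gen_ge (R : realType) (q : R) : 1 < q -> 2 / (q - 1) <= pi_gen q.
Proof.
move=> q1; have pi0 := pi_gt0 R; have q0 : 0 < q by lra.
have piq : 0 < pi / q < pi.
  by rewrite divr_gt0//= ltr_pdivrMr// ltr_pMr.
have s0 := sin_gt0_pi piq.
have : sin (pi / q) <= pi - pi / q.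
  rewrite -[leLHS]opprK -sinN -sinDpi addrC.
  by apply: sin_le_id; rewrite subr_ge0; case/andP: piq => _ /ltW.
rewrite /pi_gen ler_pdivrMr ?subr_gt0// => h.
rewrite mulrAC ler_pdivlMr ?mulr_gt0//.
apply: (@le_trans _ _ (2 * (q * (pi - pi / q)))).
  by rewrite ler_pM2l// ler_pM2l.
by rewrite mulrBr mulrCA divff ?gt_eqF//; lra.
Qed.

(** At x = pi / p, which lies in [0, 1], the bound cos 1 * x <= sin x cancels pi / p and leaves a
    constant free of p. *)
Lemma pi_gen_le (R : realType) (p : R) : pi <= p -> pi_gen p <= 2 / cos 1.
Proof.
move=> pip; have pi0 := pi_gt0 R; have p0 : 0 < p by lra.
have c0 := @cos1_gt0 R.
have : cos 1 * (pi / p) <= sin (pi / p).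
  apply: sin_ge_cos1M.
  by rewrite divr_ge0 ?(ltW pi0) ?(ltW p0)//= ler_pdivrMr// mul1r.
move=> h; have s0 : 0 < sin (pi / p).
  by apply: lt_le_trans h; rewrite mulr_gt0// divr_gt0.
rewrite /pi_gen ler_pdivrMr ?mulr_gt0// mulrAC ler_pdivlMr//.
rewrite -!mulrA ler_pM2l//.
move: h; rewrite mulrA ler_pdivrMr//; lra.
Qed.

(** * Auxiliary facts on integrals, pseudo-inverses and powers *)

Section ge0_le_integral_nomeas.
Import HBNNSimple.

(* Measurability plays no role because the integral of a nonnegative function is
   by definition a supremum over the simple functions below it. *)
Lemma ge0_le_integral_nomeas d (T : measurableType d) (R : realType)
  (mu : {measure set T -> \bar R}) (f g : T -> \bar R) :
  (forall x, 0 <= f x)%E -> (forall x, f x <= g x)%E ->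
  (\int[mu]_x f x <= \int[mu]_x g x)%E.
Proof.
move=> f0 fg; rewrite !ge0_integralTE//; last by move=> x; exact: le_trans (fg x).
apply: ereal_sup_le => _ [h hf <-].
exists h => // x; exact: le_trans (fg x).
Qed.

End ge0_le_integral_nomeas.

(** On the image of [A] the value is a preimage in [A], elsewhere it is the default [t]. This
    confines [sin_gen_quarter] to [0, 1] even at arguments not known to lie in the image. *)
Lemma pinv_dflt_in (T U : Type) (t : T) (A : set T) (f : T -> U) y :
  A t -> A ('pinv_(fun=> t) A f y).
Proof.
move=> At; rewrite /pinv_ splitV.
by rewrite oinv_surj; case: pselect => //= ?; case: cid2.
Qed.

(** The right side equals 3/16 (3/4 M)^(p-1), hence is at least 3/16 e^(2(p-1)) X^(p-1), and the
    exponential beats the linear factor p - 1. *)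
Lemma linear_powR_lt (R : realType) (X M p : R) :
  1 <= X -> 4 / 3 * (expR 2 * X) <= M -> 1 + 16 / 3 * X <= p ->
  (p - 1) * X `^ p < (4 * M)^-1 * (3 / 4 * M) `^ p.
Proof.
move=> X1 hM hp.
have e2 : 1 <= expR 2 :> R by rewrite (le_trans _ (expR_ge1Dx 2))//; lra.
have eX : 1 <= expR 2 * X by rewrite mulr_ege1.
have -> : (3 / 4 * M) `^ p = 3 / 4 * M * (3 / 4 * M) `^ (p - 1).
  by rewrite mulr_powRB1; lra.
have -> : (4 * M)^-1 * (3 / 4 * M * (3 / 4 * M) `^ (p - 1)) =
    3 / 16 * (3 / 4 * M) `^ (p - 1).
  by field; lra.
have h : (expR 2 * X) `^ (p - 1) <= (3 / 4 * M) `^ (p - 1).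
  by apply: ge0_ler_powR; rewrite ?nnegrE; lra.
apply: lt_le_trans (ler_wpM2l _ h) => //.
rewrite powRM ?expR_ge0//; last by lra.
have -> : X `^ p = X * X `^ (p - 1) by rewrite mulr_powRB1; lra.
rewrite !mulrA ltr_pM2r; last by rewrite powR_gt0; lra.
(* Each factor is at least p: one beats p - 1, and 3/16 times the other beats [X] by the lower bound
   on p. *)
have -> : expR 2 `^ (p - 1) = expR (p - 1) * expR (p - 1).
  by rewrite -expRD -expRM; congr expR; ring.
have ep := expR_ge1Dx (p - 1).
rewrite mulrA mulrC; apply: ltr_pM; lra.
Qed.

(** * The function [arcsin_gen q] and its inverse, for fixed q > 1 *)

Section arcsin_gen_theory.
Context {R : realType} (q : R).
Hypothesis q1 : 1 < q.
Local Notation mu := (@lebesgue_measure R).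
Let g (s : R) : R := (1 - s `^ q) `^ (- q^-1).
Local Notation F := (arcsin_gen q).

Let q0 : 0 < q. Proof. by rewrite (lt_trans _ q1). Qed.

Let powq_lt1 (s : R) : 0 <= s < 1 -> 0 < 1 - s `^ q.
Proof.
move=> /andP[s0 s1]; rewrite subr_gt0.
by have /(_ s 1) := gt0_ltr_powR q0; rewrite powR1; apply; rewrite ?nnegrE.
Qed.

Let integrand_homo (s t : R) : 0 <= s <= t -> t < 1 -> g s <= g t.
Proof.
move=> /andP[s0 st] t1; have t0 := le_trans s0 st.
have gs : 0 < 1 - s `^ q by rewrite powq_lt1// s0 (le_lt_trans st).
have gt : 0 < 1 - t `^ q by rewrite powq_lt1// t0 t1.
rewrite /g 2!powRN lef_pV2; [|exact: powR_gt0..].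
apply: ge0_ler_powR; rewrite ?nnegrE ?invr_ge0 ?(ltW q0) ?(ltW gs) ?(ltW gt)//.
by rewrite lerD2l lerN2; apply: (ge0_ler_powR (ltW q0)); rewrite ?nnegrE.
Qed.

Let integrand_ge1 (s : R) : 0 <= s < 1 -> 1 <= g s.
Proof.
move=> /andP[s0 s1].
suff <- : g 0 = 1 by apply: integrand_homo; rewrite ?lexx.
by rewrite /g powR0 ?gt_eqF// subr0 powR1.
Qed.

Let integrand_continuous (s : R) : 0 < s < 1 -> {for s, continuous g}.
Proof.
move=> /andP[s0 s1]; have gs : 0 < 1 - s `^ q by rewrite powq_lt1// s1 ltW.
have c a x : 0 < x -> {for x, continuous (@powR R ^~ a)}.
  move=> x0; apply/differentiable_continuous/derivable1_diffP.
  by apply: derivable_powR; rewrite in_itv/= andbT.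
apply: (@continuous_comp R R R (fun s => 1 - s `^ q) (@powR R ^~ (- q^-1))).
  by apply: cvgB; [exact: cvg_cst | exact: c].
exact: c.
Qed.

Let measurable_integrand : measurable_fun setT g.
Proof.
apply: (measurableT_comp (measurable_powR _)).
by apply: measurable_funB => //; exact: measurable_powR.
Qed.

(** By monotonicity [g] is bounded by [g x] on [0, x]. *)
Let integrable_integrand (x : R) : x < 1 -> mu.-integrable `[0, x] (EFin \o g).
Proof.
move=> x1; apply: measurable_bounded_integrable => //=.
- by rewrite lebesgue_measure_itv/=; case: ifPn => // _; rewrite -EFinB ltry.
- exact: measurable_funTS.
- exists (g x); split; first exact: num_real.
  move=> M xM s /=; rewrite in_itv/= => /andP[s0 sx].
  rewrite ger0_norm; last exact: powR_ge0.
  apply: le_trans (ltW xM); apply: integrand_homo x1.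
  by rewrite s0.
Qed.

(** The integrand is at least 1 on [0, 1[. The case y = 0 gives x <= F x, and the general case gives
    injectivity. *)
Lemma arcsin_gen_expansive (x y : R) :
  0 <= y <= x -> x < 1 -> x - y <= F x - F y.
Proof.
move=> /andP[y0 yx] x1.
rewrite /arcsin_gen Rintegral_itvB ?bnd_simp//; last exact: integrable_integrand.
have -> : x - y = \int[mu]_(s in `]y, x]) 1.
  rewrite Rintegral_cst// [X in fine X]lebesgue_measure_itv/= lte_fin mul1r.
  by move: yx; rewrite le_eqVlt => /predU1P[->|->]; rewrite ?ltxx ?subrr.
apply: le_Rintegral => //=.
- apply: measurable_bounded_integrable => //=; last exact: bounded_cst.
  by rewrite lebesgue_measure_itv/=; case: ifPn => // _; rewrite -EFinB ltry.
- apply: integrableS (integrable_integrand x1) => //.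
  by apply: subset_itvr; rewrite bnd_simp.
- move=> s; rewrite in_itv/= => /andP[ys sx].
  by rewrite integrand_ge1// (le_trans y0 (ltW ys)) (le_lt_trans sx).
Qed.

Lemma arcsin_gen0 : F 0 = 0.
Proof. by rewrite /arcsin_gen set_itv1 Rintegral_set1. Qed.

Lemma arcsin_gen_ge (x : R) : 0 <= x < 1 -> x <= F x.
Proof.
move=> /andP[x0 x1]; have := @arcsin_gen_expansive x 0.
by rewrite arcsin_gen0 !subr0; apply; rewrite // lexx.
Qed.

Lemma arcsin_gen_inj : {in `[0, 1[ &, injective F}.
Proof.
move=> x y; rewrite !in_itv/= => /andP[x0 x1] /andP[y0 y1] xy.
have [xley|/ltW ylex] := leP x y.
  have := @arcsin_gen_expansive y x; rewrite x0 xley y1 xy; lra.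
have := @arcsin_gen_expansive x y; rewrite y0 ylex x1 xy; lra.
Qed.

(* The value 0 would be the junk value of a divergent integral; proving that
   the integral converges is not needed. *)
Lemma arcsin_gen1 : F 1 = 0 \/ 1 / 2 <= F 1.
Proof.
rewrite /arcsin_gen/Rintegral.
have h : (\int[mu]_(s in `[0%R, (1 / 2)%R]) (g s)%:E <=
          \int[mu]_(s in `[0%R, 1%R]) (g s)%:E)%E.
  apply: ge0_subset_integral => //=.
  - by apply/measurable_EFinP; exact: measurable_funTS.
  - by move=> s _; rewrite lee_fin powR_ge0.
  - by apply: subset_itvl; rewrite bnd_simp; lra.
have f : (\int[mu]_(s in `[0%R, (1 / 2)%R]) (g s)%:E)%E \is a fin_num.
  by apply: integrable_fin_num => //; apply: integrable_integrand; lra.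
have [fin|] := boolP ((\int[mu]_(s in `[0%R, 1%R]) (g s)%:E)%E \is a fin_num).
  right; apply: le_trans (fine_le f fin h).
  by apply: arcsin_gen_ge; lra.
rewrite ge0_fin_numE; last by apply: integral_ge0 => s _; rewrite lee_fin powR_ge0.
by rewrite ltey negbK => /eqP ->; left.
Qed.

Lemma is_derive_arcsin_gen (x : R) : 0 < x < 1 ->
  is_derive x 1 F ((1 - x `^ q) `^ (- q^-1)).
Proof.
move=> /andP[x0 x1].
(* The upper end is taken strictly between x and 1, so that x is interior and [g] is integrable up
   to that end. *)
have xu : x < (x + 1) / 2 by lra.
have [|||d e] := @continuous_FTC1_closed R g 0 x _ xu.
- by apply: integrable_integrand; lra.
- exact: x0.
- by apply: integrand_continuous; rewrite x0.
- by split; [exact: d | rewrite -derive1E; exact: e].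
Qed.

Lemma sin_gen_quarter_itv (y : R) : 0 <= sin_gen_quarter q y <= 1.
Proof.
have := @pinv_dflt_in R R 0 `[0, 1] F y.
by rewrite /= !in_itv/= lexx ler01 => /(_ isT).
Qed.

Lemma sin_gen_quarterK (y : R) : 0 < y < 1 / 2 ->
  0 < sin_gen_quarter q y < 1 /\ F (sin_gen_quarter q y) = y.
Proof.
move=> /andP[y0 y2].
(* As F 0 = 0 and F (1/2) >= 1/2 > y, the intermediate value theorem puts y in the image of F. *)
have [c] : exists2 c, c \in `[0, 1 / 2] & F c = y.
  apply: IVT; first lra.
    by apply: parameterized_integral_continuous; [|apply: integrable_integrand]; lra.
  have h : 1 / 2 <= F (1 / 2) by apply: arcsin_gen_ge; lra.
  by rewrite arcsin_gen0 min_l ?max_r; lra.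
rewrite in_itv/= => /andP[c0 c1] cy.
have Sy : F (sin_gen_quarter q y) = y.
  apply: (pinvK (fun=> 0)); rewrite inE; exists c => //=.
  by rewrite in_itv/= c0; lra.
split=> //; have /andP[S0 S1] := sin_gen_quarter_itv y.
(* The pseudo-inverse might have picked an endpoint as preimage. But F 0 = 0 < y, and F 1 is either
   0 or at least 1/2 > y. *)
rewrite !lt_neqAle S0 S1 !andbT; apply/andP; split; apply/eqP => S.
  by move: y0; rewrite -Sy -S arcsin_gen0 ltxx.
have F1 : F 1 = y by rewrite -Sy S.
by have := arcsin_gen1; rewrite F1; lra.
Qed.

Lemma is_derive_sin_gen_quarter (y : R) : 0 < y < 1 / 2 ->
  is_derive y 1 (sin_gen_quarter q) ((1 - sin_gen_quarter q y `^ q) `^ q^-1).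
Proof.
move=> y02; have [] := sin_gen_quarterK y02.
set x := sin_gen_quarter q y => x01 Fx.
have dF := is_derive_arcsin_gen x01.
have cF z : 0 < z < 1 -> {for z, continuous F}.
  move=> z01; apply/differentiable_continuous/derivable1_diffP.
  by have [] := is_derive_arcsin_gen z01.
have gx : 0 < 1 - x `^ q by rewrite powq_lt1//; lra.
have -> : (1 - x `^ q) `^ q^-1 = ((1 - x `^ q) `^ (- q^-1))^-1.
  by rewrite powRN invrK.
rewrite -Fx; apply: is_derive_inverse => //; last by rewrite gt_eqF// powR_gt0.
(* Left inverse near x: by continuity F z stays in ]0, 1/2[, where F (S (F z)) = F z for S the
   pseudo-inverse, and injectivity of F gives S (F z) = z. *)
- near=> z.
  have z01 : 0 < z < 1.
    by apply/andP; split; near: z; [apply: lt_nbhsr|apply: lt_nbhsl]; lra.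
  have Fz : 0 < F z < 1 / 2.
    apply/andP; split; first by have := @arcsin_gen_ge z; lra.
    by near: z; apply: (cvgr_lt (F x) (cF x x01)); lra.
  have [S01 FS] := sin_gen_quarterK Fz.
  by apply: arcsin_gen_inj FS; rewrite in_itv/=; lra.
- near=> z; apply: cF.
  by apply/andP; split; near: z; [apply: lt_nbhsr|apply: lt_nbhsl]; lra.
Unshelve. all: by end_near. Qed.

(** With x the value at y, x <= F x = y < 1/4. On [0, 1] a power with exponent q > 1 decreases the
    base and one with exponent 1/q increases it, so the derivative is at least 1 - x. *)
Lemma derive_sin_gen_quarter_ge (y : R) : 0 < y < 1 / 4 ->
  3 / 4 <= (1 - sin_gen_quarter q y `^ q) `^ q^-1.
Proof.
move=> y04; have [|S01 FS] := @sin_gen_quarterK y; first lra.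
set x := sin_gen_quarter q y in S01 FS *.
have /andP[x0 x1] := S01; have xy : x <= y by rewrite -FS; apply: arcsin_gen_ge; lra.
have xq : x `^ q <= x by apply: ge1r_powR; rewrite ?x0 ltW.
have := powR_ge0 x q.
move=> xq0; have : 1 - x `^ q <= (1 - x `^ q) `^ q^-1.
  by apply: ger1_powR; [lra | rewrite invf_le1 ?ltW].
lra.
Qed.

End arcsin_gen_theory.

(** * Pointwise bounds for [phi] and its derivative *)

Lemma sin_gen_norm_le1 (R : realType) (q y : R) : `|sin_gen q y| <= 1.
Proof.
rewrite /sin_gen normrM.
have -> n : `|(-1) ^ n| = 1 :> R.
  by case: n => n; rewrite ?NegzE /= ?normfV normrX normrN1 expr1n ?invr1.
set S := sin_gen_quarter q _; rewrite mul1r.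
have /andP[S0 S1] : 0 <= S <= 1 by exact: sin_gen_quarter_itv.
by rewrite ger0_norm.
Qed.

Lemma derive_phi_ge (R : realType) (T q t : R) :
  0 < T -> 1 < q -> 1 / 2 <= pi_gen q -> 0 < t < T / (4 * pi_gen q) ->
  3 / 4 * (pi_gen q / T) <= (phi T q)^`()%classic t.
Proof.
move PE : (pi_gen q) => P T0 q1 P1 /andP[t0 t1].
have P0 : 0 < P by lra.
have PT0 : 0 < P / T by rewrite divr_gt0.
have y01 : 0 < P / T * t < 1 / 4.
  rewrite mulr_gt0//=; move: t1; rewrite ltr_pdivlMr ?mulr_gt0// => t1.
  by rewrite mulrAC ltr_pdivrMr//; lra.
have tT : t < T / 2.
  apply: lt_le_trans t1 _; rewrite ler_pM2l// lef_pV2 ?posrE ?mulr_gt0//; lra.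
have dS : is_derive (P / T * t) 1 (sin_gen_quarter q)
    ((1 - sin_gen_quarter q (P / T * t) `^ q) `^ q^-1).
  by apply: is_derive_sin_gen_quarter => //; lra.
have dL : is_derive t 1 (fun s => P / T * s) (P / T).
  by apply: is_derive_eq; rewrite /GRing.scale/= mulr1.
have dphi : is_derive t 1 (phi T q)
    ((1 - sin_gen_quarter q (P / T * t) `^ q) `^ q^-1 * (P / T)).
  apply: near_eq_is_derive (is_derive1_comp dS dL).
  (* For 0 < s < T / 2 the floor in [sin_gen] is 0 and the unreflected branch applies, so [phi T q]
     is [sin_gen_quarter q] after a linear map. *)
  near=> s.
  have s0 : 0 < s by near: s; exact: lt_nbhsr.
  have sT : s < T / 2 by near: s; exact: lt_nbhsl.
  rewrite /phi /sin_gen /= PE.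
  have -> : P * s / T / P = s / T by field; rewrite !gt_eqF.
  have -> : Num.floor (s / T) = 0.
    apply: floor_def; rewrite divr_ge0 ?ltW//= ltr_pdivrMr//; lra.
  rewrite expr0z mul1r mul0r subr0 ifT; last first.
    by rewrite ler_pdivrMr//; nra.
  by congr sin_gen_quarter; rewrite mulrAC.
rewrite derive1E; have [_ ->] := dphi.
by rewrite ler_pM2r//; apply: derive_sin_gen_quarter_ge.
Unshelve. all: by end_near. Qed.

(** * Bounds for p-th powers of norms *)

Lemma poweR_Lnorm0T (R : realType) (T p : R) (f : R -> R) : p != 0 ->
  (Lnorm0T T p f `^ p =
   \int[lebesgue_measure]_x ((fun t => (`|f t| `^ p)%:E) \_ `]0%R, T[ x))%E.
Proof.
move=> p0; rewrite /Lnorm0T poweR_Lnorm//; apply: eq_integral => x _.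
(* Off ]0, T[ both sides vanish, as 0 to the nonzero power p is 0. *)
by rewrite !patchE; case: ifPn => //= _; rewrite normr0 powR0.
Qed.

Lemma poweR_Lnorm0T_le (R : realType) (T p : R) (f : R -> R) : 0 <= T -> 0 < p ->
  (forall t, `|f t| <= 1) -> (Lnorm0T T p f `^ p <= T%:E)%E.
Proof.
move=> T0 p0 f1; rewrite poweR_Lnorm0T ?gt_eqF//.
have -> : T%:E = (\int[lebesgue_measure]_x ((cst 1 \_ `]0%R, T[) x))%E :> \bar R.
  rewrite -integral_mkcond integral_cst//= lebesgue_measure_itv/= mul1e lte_fin.
  by move: T0; rewrite le_eqVlt => /predU1P[<-|->]; rewrite ?ltxx ?sube0.
apply: ge0_le_integral_nomeas => x; rewrite !patchE/=; case: ifPn => // _.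
have := @ge0_ler_powR _ _ (ltW p0) `|f x| 1; rewrite powR1 lee_fin.
by apply; rewrite ?nnegrE.
Qed.

(** The integrand dominates the constant c^p on ]0, d[ extended by 0. *)
Lemma poweR_Lnorm0T_ge (R : realType) (T p c d : R) (f : R -> R) :
  0 <= d <= T -> 0 < p -> 0 <= c -> (forall t, 0 < t < d -> c <= `|f t|) ->
  ((c `^ p * d)%:E <= Lnorm0T T p f `^ p)%E.
Proof.
move=> /andP[d0 dT] p0 c0 cf; rewrite poweR_Lnorm0T ?gt_eqF//.
have -> : (c `^ p * d)%:E =
    (\int[lebesgue_measure]_x ((cst (c `^ p)%:E \_ `]0%R, d[) x))%E :> \bar R.
  rewrite -integral_mkcond integral_cst//= lebesgue_measure_itv/= lte_fin EFinM.
  by move: d0; rewrite le_eqVlt => /predU1P[<-|->]; rewrite ?ltxx ?sube0.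
apply: ge0_le_integral_nomeas => x; rewrite !patchE/=.
  by case: ifPn => // _; rewrite lee_fin powR_ge0.
case: ifPn => [|_]; last by case: ifPn => // _; rewrite lee_fin powR_ge0.
rewrite inE/= in_itv/= => /andP[x0 xd].
rewrite ifT; last by rewrite inE/= in_itv/= x0 (lt_le_trans xd).
rewrite lee_fin; apply: ge0_ler_powR; rewrite ?nnegrE ?(ltW p0)//.
by apply: cf; rewrite x0.
Qed.

(** * Comparison of the quotient with the eigenvalue *)

Lemma lt_dive (R : realType) (l a b : R) (X Y : \bar R) :
  0 < a -> 0 < b -> l * b < a ->
  (a%:E <= X -> 0 <= Y -> Y <= b%:E -> l%:E < X / Y)%E.
Proof.
move=> a0 b0 lab aX; case: Y => [y| |]; rewrite ?leye_eq// !lee_fin => y0 yb.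
have X0 : (0 < X)%E by rewrite (lt_le_trans _ aX)// lte_fin.
(* For y = 0 the inverse is +oo, and X > 0 makes the quotient +oo. *)
rewrite inver; case: ifPn => [_|yn0]; first by rewrite gt0_muley// ltry.
have {yn0}y0 : 0 < y by rewrite lt_neqAle eq_sym yn0.
apply: (@lt_le_trans _ _ (a%:E * (y^-1)%:E)%E).
  rewrite -EFinM lte_fin (@lt_le_trans _ _ (a / b))//.
    by rewrite ltr_pdivlMr.
  by rewrite ler_pM2l// lef_pV2.
by apply: lee_wpmul2r => //; rewrite lee_fin invr_ge0 ltW.
Qed.

Theorem lemma4p3 (R : realType) (T : R) (hT : 0 < T) (k : nat) (hk : (0 < k)%N) :
  exists q0 p0 : R,
    [/\ 1 < q0, q0 < p0 &
      forall q p : R, 1 < q -> q < q0 -> p0 < p ->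
        (Lnorm0T T p (phi T q)^`()%classic `^ p / Lnorm0T T p (phi T q) `^ p
           > (lambda T k p)%:E)%E].
Proof.
have c0 := @cos1_gt0 R; have c1 := cos_le1 (1 : R); have pi0 := pi_gt0 R.
have k1 : 1 <= k%:R :> R by rewrite ler1n.
(* [B] bounds [pi_gen p] for p >= pi, and [A] below is the threshold for [M] in [linear_powR_lt]. *)
pose B : R := 2 / cos 1.
have B1 : 1 <= B by rewrite /B ler_pdivlMr//; lra.
pose X := k%:R * B; have X1 : 1 <= X by rewrite mulr_ege1.
pose A := 4 / 3 * (expR 2 * X).
have e2 : 1 <= expR 2 :> R by rewrite (le_trans _ (expR_ge1Dx 2))//; lra.
have A1 : 1 <= A by have := mulr_ege1 e2 X1; rewrite /A; lra.
have A2 : 0 < 2 / A by rewrite divr_gt0; lra.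
(* q < 1 + 2 / A gives 2 / (q - 1) > A. In the second witness, 2 / A ensures q0 < p0, 1 + 16/3 X
   serves [linear_powR_lt], and pi serves [pi_gen_le]. *)
exists (1 + 2 / A), (1 + 2 / A + 16 / 3 * X + pi); split; [lra..|].
move=> q p q1 qq0 pp0.
have p0 : 0 < p by lra.
have MA : A <= pi_gen q.
  apply: le_trans (pi_gen_ge q1); rewrite ler_pdivlMr ?subr_gt0//.
  by rewrite -ler_pdivlMl; lra.
have pip : k%:R * pi_gen p <= X.
  by rewrite ler_pM2l; [apply: pi_gen_le; lra | lra].
move ME : (pi_gen q) => M in MA.
have M0 : 0 < M by lra.
have d0 : 0 < T / (4 * M) by rewrite divr_gt0// mulr_gt0.
have cM0 : 0 < 3 / 4 * (M / T) by rewrite mulr_gt0// divr_gt0.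
(* The numerator is bounded below using only ]0, T / (4 M)[, the denominator above by T. *)
apply: (@lt_dive _ _ ((3 / 4 * (M / T)) `^ p * (T / (4 * M))) T) => //.
- by rewrite mulr_gt0// powR_gt0.
- have pip0 : 0 <= k%:R * pi_gen p.
    rewrite mulr_ge0// (le_trans _ (pi_gen_ge _))//; last lra.
    by rewrite divr_ge0; lra.
  have h : (p - 1) * (k%:R * pi_gen p) `^ p < (4 * M)^-1 * (3 / 4 * M) `^ p.
    apply: le_lt_trans (linear_powR_lt X1 MA _); last lra.
    rewrite ler_wpM2l//; first lra.
    by apply: ge0_ler_powR; rewrite ?nnegrE; lra.
  have Ti : 0 < T^-1 by rewrite invr_gt0.
  rewrite /lambda powRM ?(ltW Ti)// (mulrA (3 / 4)).
  rewrite (@powRM _ (3 / 4 * M)) ?(ltW Ti)//; last lra.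
  (* Both sides carry the positive factor [Z * T]; cancelling it leaves [h]. *)
  set Z := T^-1 `^ p.
  rewrite [ltLHS](_ : _ = (p - 1) * (k%:R * pi_gen p) `^ p * (Z * T)); last by ring.
  rewrite [ltRHS](_ : _ = (4 * M)^-1 * (3 / 4 * M) `^ p * (Z * T)); last first.
    by field; lra.
  by rewrite ltr_pM2r// mulr_gt0// powR_gt0.
- apply: poweR_Lnorm0T_ge => //; last 2 first.
  + exact: ltW.
  + move=> t t0; apply: le_trans (ler_norm _).
    by rewrite -ME; apply: derive_phi_ge => //; rewrite ME; lra.
  rewrite ltW//= ler_pdivrMr ?mulr_gt0//; nra.
- exact: poweR_ge0.
- apply: poweR_Lnorm0T_le => //; first exact: ltW.
  by move=> t; exact: sin_gen_norm_le1.
Qed.
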